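(* Let $m \in \mathbb{N}$ and consider $CGG(2m)$. A set $C$ of edges of $CGG(2m)$ is a co-blocker if and only if $C$ is a perfect matching of $CGG(2m)$ such that: (i) every edge of $C$ has odd order; and (ii) whenever $[a,b]$ and $[a',c]$ are two edges of $C$ such that $a$ and $a'$ are adjacent vertices of $P$ (i.e. $[a,a']$ is a boundary edge of $P$), the edges $[a,b]$ and $[a',c]$ do not cross (do not intersect in a point interior to both segments).
   Context: $CGG(2m)$ denotes the complete convex geometric graph on $2m$ vertices: its vertex set $V$ is the vertex set of a convex $2m$-gon $P$ in the plane, labelled cyclically $0,1,\dots,2m-1$, and its edges are all $\binom{2m}{2}$ closed straight-line segments joining pairs of vertices (boundary edges of $P$ and diagonals). The order of an edge $[i,j]$ is $\min(|j-i|,2m-|j-i|)$; boundary edges have order $1$. A perfect matching of $CGG(2m)$ is a set of $m$ edges such that every vertex lies in exactly one of them (edges may cross). A simple perfect matching (SPM) is a set of $m$ pairwise disjoint edges (not intersecting even in an interior point). Two sets of edges meet if they have an edge in common. A blocker is a set of edges of $CGG(2m)$ of minimum cardinality among all sets of edges that meet every SPM. A co-blocker is a set of edges of $CGG(2m)$ of minimum cardinality among all sets of edges that meet every blocker. *)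

(* Defs.v *)
From HB Require Import structures.
From mathcomp Require Import all_boot all_order all_algebra.
From mathcomp Require Import reals.
Set Implicit Arguments.
Unset Strict Implicit.
Unset Printing Implicit Defensive.
Import Order.TTheory GRing.Theory Num.Theory.
Local Open Scope ring_scope.

Section Geometry.
Variables (R : realType) (n : nat).
Implicit Types (p : 'I_n -> 'rV[R]_2) (e f : {set 'I_n}) (a b c : 'rV[R]_2).

(* Twice the signed area of the triangle abc: its sign tells on which side of
   the line ab the point c lies. *)
Definition orient a b c : R :=
  (b 0 0 - a 0 0) * (c 0 1 - a 0 1) - (b 0 1 - a 0 1) * (c 0 0 - a 0 0).

(* p lists, in cyclic order (clockwise or counterclockwise), the vertices of a
   convex n-gon: for each side, all the other vertices lie strictly on the same
   side of the line carrying it. ordS is the cyclic successor on 'I_n.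
   Injectivity matters only for n = 2, where the polygon degenerates to a
   segment with two distinct endpoints. *)
Definition convex_polygon p : Prop :=
  injective p /\
  forall i j k : 'I_n, j \notin [set i; ordS i] -> k \notin [set i; ordS i] ->
    0 < orient (p i) (p (ordS i)) (p j) * orient (p i) (p (ordS i)) (p k).

(* An edge [i, j] is encoded by the pair of its endpoints [set i; j]; the
   segment it spans is recovered from the positions p of the vertices. *)
Definition in_edge p e (x : 'rV[R]_2) : Prop :=
  exists i j t, [/\ e = [set i; j], 0 <= t <= 1 & x = (1 - t) *: p i + t *: p j].

Definition in_edge_interior p e (x : 'rV[R]_2) : Prop :=
  exists i j t, [/\ e = [set i; j], 0 < t < 1 & x = (1 - t) *: p i + t *: p j].

Definition disjoint_edges p e f : Prop := ~ exists x, in_edge p e x /\ in_edge p f x.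

Definition cross p e f : Prop :=
  exists x, in_edge_interior p e x /\ in_edge_interior p f x.

End Geometry.

Definition edges (n : nat) : {set {set 'I_n}} := [set e : {set 'I_n} | #|e| == 2%N].

Definition edge_order (n : nat) (i j : 'I_n) : nat :=
  minn `|j%:Z - i%:Z|%N (n - `|j%:Z - i%:Z|%N)%N.

Definition adjacent (n : nat) (i j : 'I_n) : bool := (j == ordS i) || (i == ordS j).

Definition perfect_matching (m : nat) (M : {set {set 'I_(2 * m)}}) : Prop :=
  [/\ M \subset edges (2 * m), #|M| = m &
      forall v, exists! e, e \in M /\ v \in e].

Definition simple_perfect_matching (R : realType) (m : nat)
    (p : 'I_(2 * m) -> 'rV[R]_2) (M : {set {set 'I_(2 * m)}}) : Prop :=
  [/\ M \subset edges (2 * m), #|M| = m &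
      forall e f, e \in M -> f \in M -> e != f -> disjoint_edges p e f].

Definition meet (n : nat) (A B : {set {set 'I_n}}) : bool := A :&: B != set0.

Definition meets_all (n : nat) (F : {set {set 'I_n}} -> Prop) (B : {set {set 'I_n}}) : Prop :=
  B \subset edges n /\ forall M, F M -> meet B M.

Definition min_meets_all (n : nat) (F : {set {set 'I_n}} -> Prop) (B : {set {set 'I_n}}) : Prop :=
  meets_all F B /\ forall B', meets_all F B' -> (#|B| <= #|B'|)%N.

Definition blocker (R : realType) (m : nat) (p : 'I_(2 * m) -> 'rV[R]_2) :
    {set {set 'I_(2 * m)}} -> Prop :=
  min_meets_all (simple_perfect_matching p).

Definition co_blocker (R : realType) (m : nat) (p : 'I_(2 * m) -> 'rV[R]_2) :
    {set {set 'I_(2 * m)}} -> Prop :=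
  min_meets_all (blocker p).

(* Main.v *)
(* Label the vertices cyclically and let f(v) be the distance, going forward,
   from v to its C-partner.  For C of odd edges, (ii) says that f(v+1) < f(v)
   whenever f(v) > 1.

   A set B of m edges meeting all SPMs is a caterpillar, encoded by [walk]: start
   at the head a of an arc with last vertex z; either [a,z] is in B and the last
   two vertices of the arc are dropped, or the side from a to its successor b is
   in B, and a and z are dropped.  If the C-partner of the current vertex lies
   on the current arc, this remains so unless the next edge of B is in C; as the
   arc shrinks to an edge of B, B meets C.  The caterpillar shape is obtained by
   induction on m.  If a side [x,y] is not in B, then B meets every SPM of the
   polygon without x and y, which takes m - 1 edges, so at most one edge of B
   touches x or y.  By counting degrees some vertex y of degree at least 2 is
   preceded by a vertex x of degree at most 1; then [x,y] is in B, the vertex w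
   before x is isolated, and B minus [x,y] is a blocker of the polygon without
   w and x.

   Conversely, a set C of m edges meeting the star of odd edges at every vertex
   is a perfect matching of odd edges, and if [v,v+x] and [v+1,v+y] in C cross
   then the caterpillar [fan v x] misses C. *)
Require Import Defs.
From HB Require Import structures.
From mathcomp Require Import all_boot all_order all_algebra.
From mathcomp Require Import reals.
From mathcomp Require Import zify ring lra.
Set Implicit Arguments.
Unset Strict Implicit.
Unset Printing Implicit Defensive.
Import Order.TTheory GRing.Theory Num.Theory.
Local Open Scope ring_scope.

(** * Sums whose total forces every term to be one *)

Section Counting.
Local Open Scope nat_scope.
Variables (T : finType) (S : {set T}) (f : T -> nat).

Lemma sum_le1_eq : (forall x, x \in S -> f x <= 1) -> #|S| <= \sum_(x in S) f x ->
  forall x, x \in S -> f x = 1.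
Proof.
move=> f1 leS x xS.
have [leq1 eq1] := leqif_sum (fun y yS => leqif_eq (f1 y yS)).
have /forall_inP/(_ x xS)/eqP // : [forall (y | y \in S), f y == 1].
by rewrite -eq1 eqn_leq leq1 sum1_card.
Qed.

Lemma sum_ge1_eq : (forall x, x \in S -> 1 <= f x) -> \sum_(x in S) f x <= #|S| ->
  forall x, x \in S -> f x = 1.
Proof.
move=> f1 leS x xS.
have [leq1 eq1] := leqif_sum (fun y yS => leqif_eq (f1 y yS)).
have /forall_inP/(_ x xS)/eqP <- // : [forall (y | y \in S), 1 == f y].
by rewrite -eq1 eqn_leq leq1 sum1_card.
Qed.

End Counting.

(** * Caterpillars blocking the noncrossing matchings of a cyclic list *)

Section Lists.
Local Open Scope nat_scope.
Variable T : finType.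
Implicit Types (l r s : seq T) (a b u x y z w : T) (e : {set T}) (B C E M : {set {set T}}).

Lemma set2_eq a b x y :
  [set a; b] = [set x; y] -> (a = x /\ b = y) \/ (a = y /\ b = x).
Proof.
move=> eq_ab; have := set21 a b; have := set22 a b; rewrite eq_ab !inE.
have := set21 x y; have := set22 x y; rewrite -eq_ab !inE.
do 4![case/orP => /eqP ?]; subst; by auto.
Qed.

Lemma set2C a b : [set a; b] = [set b; a].
Proof. exact: setUC. Qed.

Lemma set2_injr a x y : [set a; x] = [set a; y] -> x = y.
Proof. by case/set2_eq=> [[]|[-> ->]]. Qed.

Lemma cards2_ex e x : #|e| = 2 -> x \in e -> exists2 y, x != y & e = [set x; y].
Proof.
case/eqP/cards2P=> a [b [ab ->]]; rewrite !inE => /orP [] /eqP ->.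
  by exists b.
by exists a; rewrite 1?eq_sym // setUC.
Qed.

Definition star B x := [set e in B | x \in e].

Lemma sum_star B (S : {set T}) :
    (forall e, e \in B -> #|e| = 2 /\ e \subset S) ->
  \sum_(x in S) #|star B x| = 2 * #|B|.
Proof.
move=> B2; under eq_bigr do rewrite -sum1_card.
under eq_bigr => x _ do (under eq_bigl do rewrite inE).
rewrite (exchange_big_dep [in B]) /=; last by move=> x e _ /andP[].
rewrite mulnC -sum_nat_const; apply: eq_bigr => e eB.
have [<- /subsetP eS] := B2 e eB; rewrite -sum1_card; apply: eq_bigl => x.
by rewrite eB /=; case: (boolP (x \in e)) => [/eS -> //|]; rewrite andbF.
Qed.

Lemma star_gt0 B x e : e \in B -> x \in e -> 0 < #|star B x|.
Proof. by move=> eB xe; apply/card_gt0P; exists e; rewrite inE eB. Qed.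

Lemma star_gt1 B x e e' :
  e \in B -> x \in e -> e' \in B -> x \in e' -> e != e' -> 1 < #|star B x|.
Proof.
move=> eB xe e'B xe' ne; apply/card_gt1P.
by exists e, e'; rewrite !inE eB xe e'B xe'.
Qed.

Lemma star_eq B x e e' : #|star B x| <= 1 ->
  e \in B -> x \in e -> e' \in B -> x \in e' -> e = e'.
Proof.
move=> le1 eB xe e'B xe'; apply/eqP; apply: contraLR le1 => ne.
by rewrite -ltnNge (star_gt1 eB xe e'B xe').
Qed.

Lemma seq_switch (P : pred T) u l : ~~ P u -> has P l ->
  exists s1 x y s2, [/\ u :: l = s1 ++ x :: y :: s2, ~~ P x & P y].
Proof.
elim: l u => //= w l IH u nPu; case: (boolP (P w)) => [Pw _ | nPw /= hP].
  by exists [::], u, w, l.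
have [s1 [x [y [s2 [-> nPx Py]]]]] := IH w nPw hP.
by exists (u :: s1), x, y, s2.
Qed.

(** Read the cycle from an element outside [P]; the first entry into [P] gives the pair. *)
Lemma cyclic_switch (P : pred T) l : has P l -> has (predC P) l ->
  exists k x y r, [/\ rot k l = x :: y :: r, ~~ P x & P y].
Proof.
move=> hP /hasP[u ul /= nPu]; have [i r Er] := rot_to ul.
have hPr : has P r.
  have : has P (rot i l) by rewrite has_rot.
  by rewrite Er /= (negPf nPu).
have [s1 [x [y [s2 [Es nPx Py]]]]] := seq_switch nPu hPr.
exists (rot_add l i (size s1)), x, y, (s2 ++ s1); split=> //.
by rewrite -rot_rot_add Er Es rot_size_cat.
Qed.

(* Noncrossing perfect matchings of a cyclic list, generated by their ears. *)
Inductive ncm : seq T -> {set {set T}} -> Prop :=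
| NcmNil : ncm [::] set0
| NcmEar x y l M : ncm l M -> ncm (x :: y :: l) ([set x; y] |: M)
| NcmRot k l M : ncm l M -> ncm (rot k l) M.

Lemma ncm_sub l M : ncm l M -> forall e, e \in M -> {subset e <= l}.
Proof.
elim=> {l M} [e | x y l M _ IH e | k l M _ IH e eM z ze]; first by rewrite inE.
  rewrite !inE => /orP[/eqP -> z | /IH el z /el zl].
    by rewrite !inE orbA => ->.
  by rewrite !inE zl !orbT.
by rewrite mem_rot (IH e).
Qed.

(** Pairing the first entry with the second, the third with the fourth, and so on, uses only sides
    outside [B]. *)
Lemma sorted_ncm B l : ~~ odd (size l) ->
  sorted (fun x y => [set x; y] \notin B) l ->
  exists2 M, ncm l M & forall e, e \in M -> e \notin B.
Proof.
have [n] := ubnP (size l); elim: n l => // n IH [|x [|y l]] //= le_n.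
  by exists set0 => [|e]; [constructor | rewrite inE].
rewrite negbK => odd_l /andP[xyB sl].
have [|||M lM MB] := IH l; first by lia.
- by [].
- exact: path_sorted sl.
exists ([set x; y] |: M); first by constructor.
by move=> e; rewrite !inE => /orP[/eqP -> | /MB].
Qed.

(** * Lower bound for the size of a blocking set *)

Definition blocks B l := forall M, ncm l M -> exists2 e, e \in M & e \in B.

Lemma blocks_rot B k l : blocks B l -> blocks B (rot k l).
Proof.
by move=> Bl M kM; apply: Bl; rewrite -(rotK k l); apply: NcmRot.
Qed.

(** An ear outside [B] can be added to any matching of the rest, which must then meet [B]
    elsewhere. *)
Lemma blocks_ear B x y l :
  blocks B (x :: y :: l) -> [set x; y] \notin B -> blocks B l.
Proof.
move=> Bl xyB M lM; have [e] := Bl _ (NcmEar x y lM).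
rewrite !inE => /orP[/eqP -> eB | eM eB]; last by exists e.
by rewrite eB in xyB.
Qed.

Lemma blocks_sub B B' l :
    (forall e, {subset e <= l} -> e \in B -> e \in B') ->
  blocks B l -> blocks B' l.
Proof.
move=> BB' Bl M lM; have [e eM eB] := Bl _ lM.
by exists e => //; apply: BB' eB => //; apply: ncm_sub eM.
Qed.

Lemma blocks_all_notin B l : uniq l -> ~~ odd (size l) ->
  (forall x, x \in l -> [set x; next l x] \notin B) -> ~ blocks B l.
Proof.
move=> Ul odd_l lB Bl.
have: cycle (fun x y => [set x; y] \notin B) l by apply: cycle_from_next.
case: l Ul odd_l {lB} Bl => [|x l] Ul odd_l Bl.
  by move=> _; have [e] := Bl _ NcmNil; rewrite inE.
rewrite /= rcons_path => /andP[pl _].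
have [M lM MB] := @sorted_ncm B (x :: l) odd_l pl.
by have [e /MB/negP] := Bl _ lM.
Qed.

(** Restricting to [l] lets an induction delete vertices while [B] stays fixed. *)
Definition inside B l := [set e in B | e \subset [set x in l]].

Lemma insideP B l e : reflect (e \in B /\ {subset e <= l}) (e \in inside B l).
Proof.
rewrite inE; apply: (iffP andP) => [] [eB el]; split=> //.
  by move=> x /(subsetP el); rewrite inE.
by apply/subsetP => x /el; rewrite inE.
Qed.

Lemma sum_star_inside B l : uniq l -> (forall e, e \in B -> #|e| = 2) ->
  \sum_(x in [set x in l]) #|star (inside B l) x| = 2 * #|inside B l|.
Proof.
move=> Ul B2; apply: sum_star => e; rewrite inE => /andP[eB ->].
by rewrite (B2 e).
Qed.

Lemma size_setl l : uniq l -> #|[set x in l]| = size l.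
Proof. by move=> Ul; rewrite cardsE; apply/card_uniqP. Qed.

(** Some side is in [B]. If a side outside [B] is followed by one in [B], deleting the endpoints of
    the first loses the second, and the remaining list needs [m] edges. If all sides are in [B],
    every degree is positive and counting incidences suffices. *)
Lemma blocks_card m B l : uniq l -> size l = 2 * m ->
  (forall e, e \in B -> #|e| = 2) -> blocks B l -> m <= #|inside B l|.
Proof.
elim: m l => // m IH l Ul Sl B2 Bl.
have step k x y r : rot k l = x :: y :: r -> [set x; y] \notin B ->
    forall e, e \in inside B l -> (x \in e) || (y \in e) -> m < #|inside B l|.
  move=> Ek xyB e el xye.
  have Uk : uniq (x :: y :: r) by rewrite -Ek rot_uniq.
  have Sr : size r = 2 * m by have := size_rot k l; rewrite Ek Sl /=; lia.
  have Br : blocks B r by apply: blocks_ear xyB; rewrite -Ek; apply: blocks_rot.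
  have Ur : uniq r by move: Uk => /= /and3P[].
  apply: leq_ltn_trans (IH r Ur Sr B2 Br) _.
  apply/proper_card/properP; split.
    apply/subsetP => f /insideP [fB fr]; apply/insideP; split=> // z /fr zr.
    by rewrite -(mem_rot k) Ek !inE zr !orbT.
  exists e => //; apply/negP => /insideP [_ er].
  move: Uk; rewrite /= inE negb_or => /and3P[/andP[_ xr] yr _].
  by case/orP: xye => /er; [rewrite (negPf xr) | rewrite (negPf yr)].
pose P x := [set x; next l x] \in B.
have nextl x : x \in l -> next l x \in l by rewrite mem_next.
have inP x : x \in l -> P x -> [set x; next l x] \in inside B l.
  move=> xl Px; apply/insideP; split=> // z; rewrite !inE.
  by case/orP=> /eqP -> //; apply: nextl.
case: (boolP (has P l)) => [hP | /hasPn nP]; last first.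
  by case: (@blocks_all_notin B l) => //; rewrite Sl; lia.
case: (boolP (has (predC P) l)) => [hnP | /hasPn nnP].
  have [k [x [y [r [Ek nPx Py]]]]] := cyclic_switch hP hnP.
  have xyr : x \in l /\ y \in l by rewrite -!(mem_rot k l) Ek !inE !eqxx !orbT.
  have Uk : uniq (rot k l) by rewrite rot_uniq.
  have nx : next l x = y by rewrite -(next_rot k Ul) Ek /= eqxx.
  apply: (step k x y r Ek _ [set y; next l y]).
  - by rewrite -nx.
  - exact: inP (proj2 xyr) Py.
  - by rewrite !inE eqxx !orbT.
rewrite -(leq_pmul2l (n1 := m.+1) (m := 2)) // -sum_star_inside //.
rewrite -Sl -(size_setl Ul) -sum1_card; apply: leq_sum => x; rewrite inE => xl.
apply: star_gt0 (inP x xl _) (set21 _ _).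
by have := nnP x xl; rewrite /= negbK.
Qed.

(* [walk l E]: E is a caterpillar on the arc l whose spine starts at the head. *)
Inductive walk : seq T -> {set {set T}} -> Prop :=
| WalkEnd a z : walk [:: a; z] [set [set a; z]]
| WalkFan a s y z E : walk (a :: s) E ->
    walk (a :: rcons (rcons s y) z) ([set a; z] |: E)
| WalkSpine a b s z E : walk (b :: s) E ->
    walk (a :: b :: rcons s z) ([set a; b] |: E).

Lemma walk_sub l E : walk l E -> forall e, e \in E -> {subset e <= l}.
Proof.
elim=> {l E} [a z e | a s y z E _ IH e | a b s z E _ IH e].
- by rewrite inE => /eqP -> x; rewrite !inE.
- rewrite !inE => /orP[/eqP -> x | /IH es x /es].
    by rewrite !(inE, mem_rcons) => /orP[->|->]; rewrite ?orbT.
  by rewrite !(inE, mem_rcons) => /orP[->|->]; rewrite ?orbT.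
- rewrite !inE => /orP[/eqP -> x | /IH es x /es].
    by rewrite !(inE, mem_rcons) => /orP[->|->]; rewrite ?orbT.
  by rewrite !(inE, mem_rcons) => /orP[->|->]; rewrite ?orbT.
Qed.

Lemma set2_neq_notin a b s x y :
  a \notin s -> x \in s -> y \in s -> [set x; y] != [set a; b].
Proof.
move=> as_ xs ys; apply/eqP => E; have := set21 a b; rewrite -E !inE.
by case/orP=> /eqP Ea; move: as_; rewrite Ea ?xs ?ys.
Qed.

(* The sides of the polygon lying in a walk form a path starting at its head. *)
Lemma walk_side x0 l E j : walk l E -> uniq l -> j.+2 < size l ->
    [set nth x0 l j.+1; nth x0 l j.+2] \in E ->
  [set nth x0 l j; nth x0 l j.+1] \in E.
Proof.
move=> lE; elim: lE j => {l E} [a z // | a s y z E sE IH | a b s z E sE IH] j Ul Hj.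
  have Uas : uniq (a :: s).
    by move: Ul; rewrite -!cats1 -catA -cat_cons cat_uniq => /andP[].
  move: Hj Ul; rewrite /= !size_rcons => Hj /andP[aN Us].
  case/setU1P=> /= [/eqP|jE].
    by rewrite (negPf (set2_neq_notin _ aN _ _)) ?mem_nth ?size_rcons // ltnW.
  have in_s i : nth x0 (rcons (rcons s y) z) i \in a :: s ->
      i < size (rcons (rcons s y) z) -> i < size s.
    rewrite inE => /orP[/eqP Ea | ns] hi; first by move: aN; rewrite -Ea mem_nth.
    rewrite -(index_uniq x0 hi Us); move: (nth _ _ _) ns => t ts.
    by rewrite -!cats1 !index_cat mem_cat ts index_mem.
  have hj1 : j.+1 < size s.
    apply: in_s; last by rewrite !size_rcons; lia.
    by apply: (walk_sub sE jE); rewrite !inE eqxx orbT.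
  have nthE i : i < size s -> nth x0 (rcons (rcons s y) z) i = nth x0 s i.
    by move=> hi; rewrite !nth_rcons !size_rcons hi (leqW hi).
  have := IH j Uas; rewrite /= ltnS => /(_ hj1).
  move: jE; rewrite !nthE ?(ltnW hj1) // => jE /(_ jE) jE'.
  rewrite inE; apply/orP; right; case: j {Hj jE} hj1 jE' => //= j hj1.
  by rewrite !nthE // 1?ltnW // ltnW.
have [aN Ubs] : a \notin b :: rcons s z /\ uniq (b :: s).
  case/andP: Ul => -> Us; have: uniq ((b :: s) ++ [:: z]) by rewrite cats1.
  by rewrite cat_uniq => /andP[].
have inbs i : i.+1 < size (a :: b :: rcons s z) ->
    nth x0 (a :: b :: rcons s z) i.+1 \in b :: rcons s z.
  by move=> hi; apply: (@mem_nth T x0 (b :: rcons s z) i).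
case/setU1P=> [/eqP|].
  by rewrite (negPf (set2_neq_notin _ aN _ _)) ?inbs // ltnW.
(* For [j = 0] the preceding side is the spine edge itself. *)
case: j Hj => [|j] Hj jE; first exact: setU11.
apply: setU1r.
move: Hj jE Ul; rewrite /= size_rcons => Hj jE /and3P[_ bN Us].
(* Otherwise the side would end at the dropped vertex [z], which is not in [b :: s]. *)
have hj : j.+1 < size s.
  rewrite ltnNge; apply/negP=> le_s.
  have Ej : j.+1 = size s by lia.
  have := walk_sub sE jE (set22 _ _).
  rewrite Ej nth_rcons ltnn eqxx inE; move: bN Us.
  rewrite mem_rcons inE negb_or rcons_uniq => /andP[bz _] /andP[/negPf -> _].
  by rewrite orbF eq_sym (negPf bz).
have := IH j Ubs; rewrite /= ltnS => /(_ hj).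
move: jE; rewrite !nth_rcons hj (ltnW hj) => jE /(_ jE).
by case: (j) hj => //= j' hj; rewrite !nth_rcons !(ltnW hj, ltnW (ltnW hj)).
Qed.

Lemma walk_cat_side s1 q x y s2 E : walk (s1 ++ q :: x :: y :: s2) E ->
    uniq (s1 ++ q :: x :: y :: s2) ->
  [set x; y] \in E -> [set q; x] \in E.
Proof.
move=> W U xyE; have := @walk_side x _ _ (size s1) W U.
have nthE k : nth x (s1 ++ [:: q, x, y & s2]) (size s1 + k) =
    nth x [:: q, x, y & s2] k by rewrite nth_cat ltnNge leq_addr addKn.
have := (nthE 0, nthE 1, nthE 2); rewrite addn0 addn1 addn2 => -[[-> ->] ->].
by apply=> //; rewrite size_cat /= !addnS !ltnS leq_addr.
Qed.

(** * Minimum blocking sets are caterpillars *)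

Definition tight m B l :=
  [/\ uniq l, size l = 2 * m,
      forall e, e \in B -> #|e| = 2 /\ {subset e <= l}, blocks B l & #|B| = m].

Lemma tight_rot m B k l : tight m B l -> tight m B (rot k l).
Proof.
case=> Ul Sl B2 Bl Bm; split; rewrite ?rot_uniq ?size_rot //.
  by move=> e eB; have [e2 el] := B2 e eB; split=> // x /el; rewrite mem_rot.
exact: blocks_rot.
Qed.

(** Without [x] and [y] the list is still blocked, which takes [m] of the [m.+1] edges. The two
    stars are disjoint from these edges, and from each other because [[set x; y]] is not in [B]. *)
Lemma tight_ear m B x y l : tight m.+1 B (x :: y :: l) ->
  [set x; y] \notin B -> #|star B x| + #|star B y| <= 1.
Proof.
case=> Ul Sl B2 Bl Bm xyB.
have [xN yN Ul'] : [/\ x \notin y :: l, y \notin l & uniq l] by apply/and3P.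
have Bl' : m <= #|inside B l|.
  apply: blocks_card (blocks_ear Bl xyB) => //; first by move: Sl => /=; lia.
  by move=> e /B2[].
have disj_xy : [disjoint star B x & star B y].
  apply/pred0P => e; apply/negP; rewrite /= !inE => /andP[/andP[eB xe] /andP[_ ye]].
  have [z xz Ee] := cards2_ex (proj1 (B2 e eB)) xe.
  move: ye xyB; rewrite Ee !inE => /orP[] /eqP Ey.
    by move: xN; rewrite Ey inE eqxx.
  by rewrite Ey -Ee eB.
have disj_l : [disjoint star B x :|: star B y & inside B l].
  apply/pred0P => e; apply/negP; rewrite /= => /andP[+ /insideP[_ el]].
  rewrite !inE -andb_orr => /andP[_ /orP[/el xl|/el yl]].
    by move: xN; rewrite inE xl orbT.
  by rewrite yl in yN.
have subB : star B x :|: star B y :|: inside B l \subset B.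
  by apply/subsetP => e; rewrite !inE -andb_orr -andb_orr => /andP[].
have := subset_leq_card subB; rewrite Bm.
have := leq_card_setU (star B x :|: star B y) (inside B l).
rewrite disj_l => -[_ /eqP ->].
have := leq_card_setU (star B x) (star B y).
by rewrite disj_xy => -[_ /eqP ->]; lia.
Qed.

Lemma tight_star m B l : tight m B l -> \sum_(x in [set x in l]) #|star B x| = 2 * m.
Proof.
case=> Ul Sl B2 Bl Bm; rewrite -Bm; apply: sum_star => e /B2 [e2 el].
by split=> //; apply/subsetP => x /el; rewrite inE.
Qed.

(** The average degree is one, so not all degrees exceed one. Nor are all equal to one: [tight_ear]
    would then put two consecutive sides in [B], giving their common vertex degree two. *)
Lemma tight_switch m B l : tight m.+2 B l ->
  exists k x y r, [/\ rot k l = x :: y :: r, #|star B x| <= 1 & 1 < #|star B y|].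
Proof.
move=> tB; have [Ul Sl _ _ _] := tB; have sumB := tight_star tB.
pose P x := 1 < #|star B x|.
suff [hP hnP] : has P l /\ has (predC P) l.
  have [k [x [y [r [Ek nPx Py]]]]] := cyclic_switch hP hnP.
  by exists k, x, y, r; split=> //; rewrite leqNgt.
split; apply/negP => /negP/hasPn nP.
  have st1 x : x \in l -> #|star B x| = 1.
    rewrite -[x \in l](in_set (mem l)); apply: (sum_le1_eq (f := fun x => #|star B x|)).
      by move=> y; rewrite inE => /nP; rewrite -leqNgt.
    by rewrite size_setl // sumB Sl.
  case: l Ul Sl tB {sumB nP} st1 => [|x [|y [|z l]]] //=; try lia.
  move=> /and4P[xN yN _ _] Sl tB st1.
  have xyB : [set x; y] \in B.
    apply/negPn/negP => /(tight_ear tB).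
    by rewrite !st1 // !inE eqxx ?orbT.
  have yzB : [set y; z] \in B.
    apply/negPn/negP; move: (tight_rot 1 tB); rewrite rot1_cons => tB1.
    by move/(tight_ear tB1); rewrite !st1 // !inE eqxx ?orbT.
  have := st1 y; rewrite !inE eqxx orbT => /(_ isT) sty.
  have: [set x; y] = [set y; z].
    by apply: (star_eq (x := y) _ xyB _ yzB); rewrite ?sty // !inE eqxx ?orbT.
  rewrite set2C => /set2_injr Exz; move: xN.
  by rewrite Exz !inE eqxx orbT.
have: \sum_(i in [set x0 in l]) 2 <= \sum_(i in [set x0 in l]) #|star B i|.
  by apply: leq_sum => y; rewrite inE => /nP; rewrite /= negbK.
by rewrite sum_nat_const size_setl // sumB Sl; lia.
Qed.

(** The leaf [[set a; y]] of the fan at [a] can be read instead as a first spine edge, from [y] to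
    [a]. *)
Lemma walk_rotate a s y E : walk (a :: rcons s y) E -> uniq (a :: rcons s y) ->
  [set a; y] \in E -> walk (y :: a :: s) E.
Proof.
move Hl: (a :: rcons s y) => l lE; case: lE Hl => {l E}.
- move=> b z [-> ]; case: s => [|c s] //=; last by case: s.
  by move=> [->] _ _; rewrite set2C; constructor.
- move=> b s1 y1 z E sE [->] /rcons_inj [-> ->] _ _; rewrite set2C.
  exact: WalkSpine.
move=> b c s1 z E sE [->]; case: s => [|d s] /=.
  by case=> _; case: s1 sE.
case=> -> /rcons_inj [-> ->] /andP[aN U] /setU1P [/set2_injr Ez | ayE].
  by move: U; rewrite /= mem_rcons Ez inE eqxx.
have := walk_sub sE ayE (set21 _ _); move: aN.
by rewrite !inE mem_rcons inE !negb_or; case/and3P=> /negPf-> _ /negPf->.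
Qed.

Lemma rot_uniq_cat k y l s1 s2 :
  uniq (y :: l) -> rot k (y :: l) = s1 ++ y :: s2 -> l = s2 ++ s1.
Proof.
move=> /andP[yl _] Ek.
have: rot (size s1) (rot k (y :: l)) = y :: s2 ++ s1 by rewrite Ek rot_size_cat.
rewrite rot_rot_add; case: (rot_add _ _ _) => [|j]; first by rewrite rot0 => -[].
case: (leqP (size (y :: l)) j.+1) => [le_l | /= lt_j].
  by rewrite rot_oversize // => -[].
rewrite /rot /= -cat1s (drop_nth y) //= => -[Ey _].
by move: yl; rewrite -{1}Ey mem_nth.
Qed.

(** The closing edge [[set a; z]] strengthens the induction: it allows restarting the walk at its
    other end, and it gives [a] a second edge when the last case is refuted. *)
Theorem tight_walk m B l : tight m.+1 B l ->
  exists k a s z, [/\ rot k l = a :: rcons s z, walk (rot k l) B & [set a; z] \in B].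
Proof.
elim: m l B => [|m IH] l B tB.
  have [Ul Sl B2 Bl Bm] := tB.
  case: l Ul Sl B2 Bl {tB} => [|a [|z [|? ?]]] // Ul _ B2 Bl.
  have azB : [set a; z] \in B.
    by have [e] := Bl _ (NcmEar a z NcmNil); rewrite !inE orbF => /eqP ->.
  exists 0, a, [::], z; rewrite rot0; split=> //.
  move/eqP/cards1P: Bm azB => [e ->]; rewrite inE => /eqP <-; constructor.
have [k [x [y [r [Ek stx sty]]]]] := tight_switch tB.
have {}tB := tight_rot k tB; rewrite Ek in tB.
have xyB : [set x; y] \in B by apply/negPn/negP => /(tight_ear tB); lia.
case/lastP: r Ek tB => [|l1 w] Ek tB; first by case: tB => _ /=; lia.
pose l0 := w :: x :: y :: l1.
have El0 : l0 = rot (size (x :: y :: l1)) (rot k l).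
  by rewrite Ek /l0 -!rcons_cons -cats1 rot_size_cat.
have tB0 : tight m.+2 B l0 by rewrite El0 Ek; apply: tight_rot.
have [U0 S0 B2 Bl0 Bm] := tB0.
have [wN xN yN Ul1] : [/\ w \notin x :: y :: l1, x \notin y :: l1,
  y \notin l1 & uniq l1] by apply/and4P.
have onlyx e : e \in B -> x \in e -> e = [set x; y].
  by move=> eB xe; apply: star_eq stx eB xe xyB (set21 _ _).
have stx1 : 0 < #|star B x| by apply: star_gt0 xyB (set21 _ _).
have wxB : [set w; x] \notin B.
  apply/negP => /onlyx; rewrite set22 => /(_ isT).
  rewrite set2C => /set2_injr Ewy; move: wN.
  by rewrite Ewy !inE eqxx orbT.
have stw : #|star B w| = 0 by have := tight_ear tB0 wxB; lia.
have onlyw e : e \in B -> w \notin e.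
  by move=> eB; apply/negP => we; have := star_gt0 eB we; rewrite stw.
pose B' := B :\ [set x; y].
have EB : B = [set x; y] |: B' by rewrite setD1K.
have B'l e : e \in B' -> {subset e <= y :: l1}.
  rewrite in_setD1 => /andP[ne eB] z ze; have [_ /(_ z ze)] := B2 e eB.
  rewrite !inE => /or3P[/eqP Ez | /eqP Ez | //].
    by have := onlyw e eB; rewrite -Ez ze.
  by case/eqP: ne; apply: onlyx => //; rewrite -Ez.
have tB' : tight m.+1 B' (y :: l1).
  split; first by apply/andP.
  - by move: S0 => /=; lia.
  - move=> e eB'; split; last exact: B'l.
    by move: eB'; rewrite in_setD1 => /andP[_ /B2[]].
  - apply: blocks_sub (blocks_ear Bl0 wxB) => e el eB.
    rewrite in_setD1 eB andbT; apply: contra xN => /eqP Ee.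
    by apply: el; rewrite Ee set21.
  by move: Bm; rewrite EB cardsU1 in_setD1 eqxx /=; lia.
have [k' [a [s [z [Ek' W azB']]]]] := IH _ _ tB'.
have Uy : uniq (y :: l1) by apply/andP.
have Uas : uniq (a :: rcons s z) by rewrite -Ek' rot_uniq; apply/andP.
have rot_l i t : rot i l0 = t -> exists j, rot j l = t.
  by rewrite El0 !rot_rot_add => <-; eexists.
have [j Ej] : exists j, rot j l = y :: rcons (rcons l1 w) x.
  by apply: (rot_l 2); rewrite -!cats1 -catA.
have : y \in a :: rcons s z by rewrite -Ek' mem_rot inE eqxx.
(* The edge [[set x; y]] is to be added as a last leaf of a fan at [y], so the walk of [B'] has to
   start at [y]. On the arc found by induction, [y] may be first, last or interior. *)
rewrite inE mem_rcons inE => /or3P[/eqP Ey | /eqP Ey | ys].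
- subst a; have El1 : l1 = rcons s z.
    by rewrite (rot_uniq_cat (s1 := [::]) Uy Ek') cats0.
  exists j, y, (rcons (rcons s z) w), x; rewrite -El1 [[set y; x]]set2C; split=> //.
  by rewrite Ej El1 EB set2C; apply: WalkFan; rewrite -Ek'.
(* Here [y] ends the arc, and the closing edge moves the start of the walk to it. *)
- subst z; have El1 : l1 = a :: s.
    by move: Ek'; rewrite -cats1 -cat_cons => /(rot_uniq_cat Uy) ->.
  exists j, y, (rcons (a :: s) w), x; rewrite -El1 [[set y; x]]set2C; split=> //.
  rewrite Ej El1 EB set2C; apply: WalkFan; apply: walk_rotate => //.
  by rewrite -Ek'.
(* An interior [y], with [q] before it and [p] after it, is impossible. As [y] has degree at least
   two, [[set y; p]] is in [B], hence so is [[set q; y]] by [walk_side]. But [q] is next to the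
   isolated [w] in the full cycle, so its degree is at most one. *)
case/splitPr: ys Ek' W azB' Uas => s1 s2 Ek' W azB' Uas.
rewrite Ek' in W; rewrite rcons_cat rcons_cons -cat_cons in Ek' W Uas.
have El1 := rot_uniq_cat Uy Ek'.
have [p [t Ep]] : exists p t, rcons s2 z = p :: t.
  by case: (s2) => [|p t]; eexists; eexists.
have [r [q Eq]] : exists r q, a :: s1 = rcons r q.
  by exists (belast a s1), (last a s1); rewrite -lastI.
have ypB : [set y; p] \in B.
  have := tight_rot 2 tB0; rewrite /l0 El1 Ep -[rot 2 _]/(y :: p :: _) => tB2.
  apply/negPn/negP => /(tight_ear tB2) le1.
  by have := leq_trans sty (leq_trans (leq_addr _ _) le1).
have ypB' : [set y; p] \in B'.
  rewrite in_setD1 ypB andbT; apply: contra xN => /eqP Exy.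
  have: x \in [set y; p] by rewrite Exy set21.
  by rewrite El1 Ep !inE => /orP[] ->; rewrite ?orbT.
have stq : #|star B q| <= 1.
  have := tight_rot (size (w :: x :: y :: rcons s2 z ++ r)) tB0.
  have -> : l0 = (w :: x :: y :: rcons s2 z ++ r) ++ [:: q].
    by rewrite cats1 /l0 El1 Eq -rcons_cat.
  rewrite rot_size_cat /= => tBq; have := tight_ear tBq; rewrite stw addn0; apply.
  by apply/negP => /onlyw; rewrite !inE eqxx orbT.
rewrite Eq cat_rcons Ep in W Uas.
have qyB' := walk_cat_side W Uas ypB'.
have sub_star e : e \in B' -> e \in B by rewrite in_setD1 => /andP[].
have two_edges q' : [set q'; q] \in B' -> q' != y -> False.
  move=> /sub_star q'B /eqP ne; apply: ne.
  have := star_eq stq q'B (set22 _ _) (sub_star _ qyB') (set21 _ _).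
  by rewrite set2C => /set2_injr.
(* The second edge at [q] is the closing edge if [q] heads the arc, and otherwise the side before
   it. *)
exfalso; case/lastP: r Eq W Uas => [[Ea Es1] | r q' Eq] W Uas.
  apply: (two_edges z); first by rewrite set2C -Ea.
  have : y \notin rcons s2 z by rewrite Ep; case/and3P: Uas.
  by rewrite mem_rcons inE negb_or eq_sym => /andP[].
rewrite cat_rcons in W Uas.
apply: (two_edges q'); first exact: walk_cat_side W Uas qyB'.
move: Uas; rewrite cat_uniq => /and3P[_ _ /= /andP[+ _]].
by rewrite !inE !negb_or => /and3P[].
Qed.

End Lists.

(** * Catching a partner along a caterpillar *)

Section Positions.
Local Open Scope nat_scope.
Variable T : finType.
Implicit Types (l : seq T) (C E M : {set {set T}}).

Lemma walk_even l E : walk l E -> odd (size l) = false.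
Proof.
by elim=> {l E} // [a s y z E _ | a b s z E _] IH; rewrite /= !size_rcons /= negbK.
Qed.

(* Walking along the caterpillar, the C-partner of the current vertex stays on
   the current arc, which shrinks until the partner is caught. *)
Lemma walk_meets (v : nat -> T) C n x0 :
    (forall i k, i < n -> k < n -> [set v i; v k] \in C -> odd i != odd k) ->
    (forall i x : nat, i.+1 < x < n -> [set v i; v x] \in C ->
       exists2 y : nat, i.+1 < y < x & [set v i.+1; v y] \in C) ->
  forall l E, walk l E -> forall j x : nat, j + size l <= n ->
    (forall k, k < size l -> nth x0 l k = v (j + k)) ->
    j < x < j + size l -> [set v j; v x] \in C ->
  exists2 e, e \in E & e \in C.
Proof.
move=> parC nestC l E; elim=> {l E} [a z | a s y z E sE IH | a b s z E sE IH] j x.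
- move=> le_n lv jx jxC; exists [set a; z]; first by rewrite inE.
  have := lv 0 isT; have := lv 1 isT; rewrite /= addn0 => -> ->.
  by have -> : j + 1 = x by move: jx => /=; lia.
- rewrite /= !size_rcons => le_n lv jx jxC.
  have := lv 0 isT; rewrite /= addn0 => Ea.
  have Ez : z = v (j + (size s).+2).
    by rewrite -lv ?size_rcons //= nth_rcons size_rcons ltnn eqxx.
  case: (ltngtP x (j + (size s).+1)) => [lt_x | gt_x | Ex].
  + have [|k /= lt_k||e eE eC] := IH j x _ _ _ jxC; rewrite /=; try lia.
      rewrite -lv; last by rewrite leqW // leqW.
      case: k lt_k => //= k; rewrite ltnS => lt_k.
      by rewrite !nth_rcons size_rcons lt_k leqW.
    by exists e; rewrite // !inE eE orbT.
  + exists [set a; z]; first by rewrite setU11.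
    by rewrite Ea Ez; have <- : x = j + (size s).+2 by lia.
  (* The partner is not the dropped vertex [y]: the inner arc has even length, so [a] and [y] sit at
     positions of equal parity. *)
  + have := walk_even sE; have := parC j x _ _ jxC; rewrite Ex oddD /=.
    by case: (odd j); case: (odd (size s)) => // -> //; lia.
rewrite /= !size_rcons => le_n lv jx jxC.
have := lv 0 isT; have := lv 1 isT; rewrite /= addn0 addn1 => Eb Ea.
case: (ltngtP j.+1 x) => [lt_x | gt_x | Ex]; last 2 first.
- by move: gt_x; lia.
- by exists [set a; b]; rewrite ?setU11 // Ea Eb Ex.
(* The partner of the next vertex comes before [x], so it is not the dropped [z]. *)
have [|y jy jyC] := nestC j x _ jxC; first by lia.
have [|k /= lt_k||e eE eC] := IH j.+1 y _ _ _ jyC; rewrite /=; try lia.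
  rewrite addSnnS -lv; last by rewrite ltnS leqW.
  case: k lt_k => //= k; rewrite ltnS => lt_k.
  by rewrite !nth_rcons lt_k.
by exists e; rewrite // !inE eE orbT.
Qed.

(** * Cyclically invariant relations on the triples of a list *)

Fixpoint triwise (t : T -> T -> T -> bool) l :=
  if l is x :: l' then pairwise (t x) l' && triwise t l' else true.

Lemma triwise_nth (t : T -> T -> T -> bool) x0 l :
    (forall i j k, i < j < k -> k < size l -> t (nth x0 l i) (nth x0 l j) (nth x0 l k)) ->
  triwise t l.
Proof.
elim: l => //= x l IH tl; apply/andP; split.
  apply/(pairwiseP x0) => i j; rewrite !inE => il jl ij.
  by apply: (tl 0 i.+1 j.+1).
by apply: IH => i j k ijk kl; apply: (tl i.+1 j.+1 k.+1).
Qed.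

Lemma triwise_rcons (t : T -> T -> T -> bool) l x :
  triwise t (rcons l x) = pairwise (fun y z => t y z x) l && triwise t l.
Proof.
elim: l => //= y l ->; rewrite pairwise_rcons.
by case: (all _ _); case: (pairwise _ l); case: (pairwise _ l); case: (triwise _ _).
Qed.

Lemma triwise_rot (t : T -> T -> T -> bool) k l : (forall x y z, t x y z = t y z x) ->
  triwise t l -> triwise t (rot k l).
Proof.
move=> tC tl; elim: k => [|k IH]; first by rewrite rot0.
case: (ltnP k (size l)) => [lt_k | le_k]; last by rewrite rot_oversize // leqW.
rewrite -add1n rotD // ; case: (rot k l) IH => // x s /= /andP[xs ts].
rewrite rot1_cons triwise_rcons ts andbT; apply: sub_pairwise xs => y z.
by rewrite tC.
Qed.

(** With [t] as orientation and [P] as disjointness: all remaining vertices lie on one side of an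
    ear, so it is disjoint from the other edges. Cyclic invariance of [t] takes care of
    rotations. *)
Lemma ncm_pairwise (P : {set T} -> {set T} -> Prop)
    (t : T -> T -> T -> bool) l M :
    (forall x y z, t x y z = t y z x) ->
    (forall a b c d, t a b c -> t a b d ->
       P [set a; b] [set c; d] /\ P [set c; d] [set a; b]) ->
    ncm l M -> uniq l -> triwise t l ->
  [/\ forall e, e \in M -> #|e| = 2, 2 * #|M| = size l &
      forall e f, e \in M -> f \in M -> e != f -> P e f].
Proof.
move=> tC tP; elim=> {l M} [|x y l M lM IH|k l M lM IH].
- by move=> _ _; split=> [e||e f]; rewrite ?inE ?cards0.
- move=> /= /and3P[]; rewrite inE negb_or => /andP[xy xl] yl Ul /andP[/andP[txy _] /andP[_ tl]].
  have [M2 SM MP] := IH Ul tl.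
  have earP e : e \in M -> P [set x; y] e /\ P e [set x; y].
    move=> eM; have e_l := ncm_sub lM eM.
    have /eqP/cards2P [c [d [_ Ee]]] := M2 e eM.
    rewrite Ee; apply: tP; apply: (allP txy); apply: e_l; rewrite Ee ?set21 ?set22 //.
  split.
  + by move=> e /setU1P[-> | /M2 //]; rewrite cards2 xy.
  + rewrite cardsU1 mulnDr SM; case: (boolP (_ \in M)) => [/(ncm_sub lM)/(_ x) | _ //].
    by rewrite set21 => /(_ isT); rewrite (negPf xl).
  + move=> e f /setU1P[-> | eM] /setU1P[-> | fM]; rewrite ?eqxx //.
    * by case: (earP f fM).
    * by case: (earP e eM).
    * exact: MP.
move=> Uk tk; rewrite size_rot; apply: IH; first by rewrite -(rot_uniq k).
by rewrite -(rotK k l); apply: triwise_rot.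
Qed.

End Positions.

(** * Convex position *)

Section Cyclic.
Local Open Scope nat_scope.
Variable n : nat.
Implicit Types v w : 'I_n.

Lemma val_iter_ordS k v : val (iter k (@ordS n) v) = (v + k) %% n.
Proof.
elim: k => [|k IH] /=; first by rewrite addn0 modn_small.
by rewrite IH -addn1 modnDml -addnA addn1.
Qed.

Lemma iter_ordS_inj v i k : i < n -> k < n ->
  iter i (@ordS n) v = iter k (@ordS n) v -> i = k.
Proof.
move=> lt_i lt_k /(congr1 val); rewrite !val_iter_ordS => /eqP.
by rewrite eqn_modDl !modn_small // => /eqP.
Qed.

Lemma iter_ordS_onto v w : exists2 k, k < n & w = iter k (@ordS n) v.
Proof.
have n_gt0 : 0 < n by apply: leq_ltn_trans (ltn_ord v).
exists ((w + (n - v)) %% n); first by rewrite ltn_mod.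
apply/val_inj; rewrite val_iter_ordS modnDmr addnCA subnKC 1?ltnW //.
by rewrite modnDr modn_small.
Qed.

Lemma iter_ordS_period v : iter n (@ordS n) v = v.
Proof. by apply/val_inj; rewrite val_iter_ordS modnDr modn_small. Qed.

End Cyclic.

(** * Orientation, crossing and nesting of chords *)

Section Convex.
Variables (R : realType) (n : nat) (p : 'I_n -> 'rV[R]_2).
Implicit Types (a b c d v : 'I_n) (x : 'rV[R]_2).

Lemma orientC (a b c : 'rV[R]_2) : orient a b c = orient b c a.
Proof. by rewrite /orient; ring. Qed.

Lemma orientN (a b c : 'rV[R]_2) : orient a b c = - orient a c b.
Proof. by rewrite /orient; ring. Qed.

(** The three-term Grassmann-Pluecker relation for the vectors issuing from [o]. *)
Lemma orient_plucker (o u a b c : 'rV[R]_2) :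
  orient o u b * orient o a c =
  orient o u a * orient o b c + orient o u c * orient o a b.
Proof. by rewrite /orient; ring. Qed.

Lemma orient_line (a b c d : 'rV[R]_2) t :
  orient a b ((1 - t) *: c + t *: d) =
  (1 - t) * orient a b c + t * orient a b d.
Proof. by rewrite /orient !mxE; ring. Qed.

Lemma in_edgeP a b x : in_edge p [set a; b] x ->
  exists2 t : R, 0 <= t <= 1 & x = (1 - t) *: p a + t *: p b.
Proof.
case=> i [j [t [/set2_eq[[-> ->]|[-> ->]] t01 ->]]]; first by exists t.
by exists (1 - t); [lra | rewrite subKr addrC].
Qed.

Lemma in_edge_interiorW (e : {set 'I_n}) x : in_edge_interior p e x -> in_edge p e x.
Proof.
case=> i [j [t [-> /andP[t0 t1] ->]]]; exists i, j, t; split=> //.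
by rewrite !ltW.
Qed.

(** The points [c] and [d] lie strictly on one side of the line through [a] and [b], hence so does
    the whole segment between them. *)
Lemma edges_apart (s : R) a b c d x :
    0 < s * orient (p a) (p b) (p c) -> 0 < s * orient (p a) (p b) (p d) ->
  in_edge p [set a; b] x -> in_edge p [set c; d] x -> False.
Proof.
move=> sc sd /in_edgeP [t _ Ex] /in_edgeP [u /andP[u0 u1] Ex'].
have : s * orient (p a) (p b) x = 0 by rewrite Ex /orient !mxE; ring.
rewrite Ex' orient_line mulrDr [s * (_ * _)]mulrCA [s * (u * _)]mulrCA => E0.
have [u_eq0 | u_neq0] := eqVneq u 0.
  by move: E0; rewrite u_eq0 subr0 mul1r mul0r addr0 => E0; rewrite E0 ltxx in sc.
have ge0 : 0 <= (1 - u) * (s * orient (p a) (p b) (p c)).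
  by rewrite mulr_ge0 ?subr_ge0 ?(ltW sc).
have gt0 : 0 < u * (s * orient (p a) (p b) (p d)) by rewrite mulr_gt0 // lt0r u_neq0.
by have := ltr_wpDl ge0 gt0; rewrite E0 ltxx.
Qed.

Section Oriented.
Variable s : R.
Hypothesis ccw : forall v i j k, (i < j < k)%N -> (k < n)%N ->
  0 < s * orient (p (iter i (@ordS n) v)) (p (iter j (@ordS n) v)) (p (iter k (@ordS n) v)).

Lemma interleaved_cross v i j k l : (i < j < k)%N -> (k < l < n)%N ->
  cross p [set iter i (@ordS n) v; iter k (@ordS n) v]
          [set iter j (@ordS n) v; iter l (@ordS n) v].
Proof.
move=> ijk /andP[kl ln]; have /andP[ij jk] := ijk.
have kn := ltn_trans kl ln; have jl := ltn_trans jk kl; have ik := ltn_trans ij jk.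
have il := ltn_trans ij jl.
set a := iter i _ v; set b := iter j _ v; set c := iter k _ v; set d := iter l _ v.
have abc : 0 < s * orient (p a) (p b) (p c) by apply: ccw; rewrite ?ij.
have abd : 0 < s * orient (p a) (p b) (p d) by apply: ccw; rewrite ?ij.
have acd : 0 < s * orient (p a) (p c) (p d) by apply: ccw; rewrite ?ik.
have bcd : 0 < s * orient (p b) (p c) (p d) by apply: ccw; rewrite ?jk.
(* [D] is [s] times twice the signed area of the quadrilateral [abcd], split along either diagonal.
   The weights [t] and [u] of the crossing point are ratios of triangle areas. *)
pose D := s * orient (p a) (p b) (p d) + s * orient (p b) (p c) (p d).
have D0 : 0 < D by apply: addr_gt0.
have ED : D = s * orient (p a) (p b) (p c) + s * orient (p a) (p c) (p d).
  by rewrite /D /orient; ring.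
pose t := s * orient (p a) (p b) (p d) / D.
pose u := s * orient (p a) (p b) (p c) / D.
exists ((1 - t) *: p a + t *: p c); split; [exists a, c, t | exists b, d, u]; split=> //.
- by rewrite /t divr_gt0 //= ltr_pdivrMr // mul1r /D ltrDl.
- by rewrite /u divr_gt0 //= ltr_pdivrMr // mul1r ED ltrDl.
have E1 : 1 - t = s * orient (p b) (p c) (p d) / D.
  rewrite /t; apply: (mulIf (lt0r_neq0 D0)).
  by rewrite mulrBl !divfK ?lt0r_neq0 // mul1r /D addrC addKr.
have E2 : 1 - u = s * orient (p a) (p c) (p d) / D.
  rewrite /u; apply: (mulIf (lt0r_neq0 D0)).
  by rewrite mulrBl !divfK ?lt0r_neq0 // mul1r ED addrC addKr.
rewrite E1 E2; apply/rowP => h; rewrite !mxE /t /u; apply: (mulIf (lt0r_neq0 D0)).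
have mulD (y z : R) : y / D * z * D = y * z by rewrite mulrAC divfK ?lt0r_neq0.
rewrite !mulrDl !mulD.
have [->|->] : h = 0 \/ h = 1.
  by case: h => [[|[|//]] h]; [left|right]; apply: val_inj.
- by rewrite /orient; ring.
- by rewrite /orient; ring.
Qed.

Lemma interleaved_meet v i j k l : (i < j < k)%N -> (k < l < n)%N ->
  ~ disjoint_edges p [set iter i (@ordS n) v; iter k (@ordS n) v]
          [set iter j (@ordS n) v; iter l (@ordS n) v].
Proof.
move=> ijk kln; have [x [xe xf]] := interleaved_cross v ijk kln.
by apply; exists x; split; apply: in_edge_interiorW.
Qed.

Lemma nested_not_cross v i j k l : (i < j < k)%N -> (k < l < n)%N ->
  ~ cross p [set iter i (@ordS n) v; iter l (@ordS n) v]
          [set iter j (@ordS n) v; iter k (@ordS n) v].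
Proof.
move=> ijk /andP[kl ln] [x [/in_edge_interiorW xe /in_edge_interiorW xf]].
have /andP[ij jk] := ijk.
(* Both inner vertices lie on the negative side of the outer chord, whence [- s]. *)
apply: (edges_apart (s := - s) _ _ xe xf); rewrite orientN mulrNN; apply: ccw => //.
  by rewrite ij (ltn_trans jk).
by rewrite kl andbT (ltn_trans ij).
Qed.

End Oriented.

(** A triangle on three consecutive vertices contains two sides, which carries the sign around the
    polygon. Triples starting at a fixed [v] follow by induction on the last index, through
    [orient_plucker]. The factor [s] covers both cyclic directions. *)
Lemma convex_ccw : convex_polygon p ->
  exists s : R, forall v i j k, (i < j < k)%N -> (k < n)%N ->
  0 < s * orient (p (iter i (@ordS n) v)) (p (iter j (@ordS n) v)) (p (iter k (@ordS n) v)).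
Proof.
move=> [_ hp]; have [le_n | lt_n] := leqP n 2.
  (* With at most two vertices there are no triples, and any [s] will do. *)
  by exists 0 => v i j k /andP[ij jk] kn; lia.
pose V v k := iter k (@ordS n) v.
have VN v i j : (i < n)%N -> (j < n)%N -> i != j -> V v i != V v j.
  by move=> hi hj; apply: contra => /eqP/iter_ordS_inj ->.
have VS v j : (1 < j < n)%N -> V v j \notin [set v; ordS v].
  move=> /andP[j1 jn]; rewrite !inE negb_or.
  by rewrite (VN v j 0%N) ?(VN v j 1%N) //; lia.
pose o v j := orient (p v) (p (ordS v)) (p (V v j)).
have n_gt0 : (0 < n)%N by lia.
pose v0 := Ordinal n_gt0; exists (o v0 2%N).
set s := o v0 2%N.
have trans (x y : R) : 0 < s * x -> 0 < x * y -> 0 < s * y.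
  move=> sx xy; have x0 : x != 0 by apply: contraTneq sx => ->; rewrite mulr0 ltxx.
  have E : x ^+ 2 * (s * y) = s * x * (x * y) by ring.
  by have := mulr_gt0 sx xy; rewrite -E pmulr_rgt0 // exprn_even_gt0.
have same v : 0 < s * o v 2%N.
  have [k _ ->] := iter_ordS_onto v0 v.
  elim: k => [|k IH] /=; first by apply: (hp); apply: VS.
  set w := iter k _ _ in IH *; apply: trans IH _.
  rewrite /o [X in X * _]orientC; apply: (hp (ordS w)); last exact: VS.
  by rewrite !inE negb_or (VN w 0%N 1%N) ?(VN w 0%N 2%N) //; lia.
clearbody s; have first v j : (1 < j < n)%N -> 0 < s * o v j.
  by move=> hj; apply: trans (same v) _; apply: (hp); apply: VS.
have base v j k : (0 < j < k)%N -> (k < n)%N -> 0 < s * orient (p v) (p (V v j)) (p (V v k)).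
  elim: k => [|k IH] /andP[j0] //; rewrite ltnS leq_eqVlt => /orP[/eqP <- | jk] kn.
    (* Seen from the side starting at [V v j], the vertex [v] is [n - j] steps ahead. *)
    rewrite orientC; have := first (V v j) (n - j)%N.
    by rewrite /o /V -iterD subnK ?iter_ordS_period; [apply; lia | lia].
  have [j1 | j1] := leqP j 1.
    have -> : j = 1%N by lia.
    by apply: first; lia.
  have hk : 0 < s * orient (p v) (p (ordS v)) (p (V v k)) by apply: first; lia.
  have hj : 0 < s * orient (p v) (p (ordS v)) (p (V v j)) by apply: first; lia.
  have hk1 : 0 < s * orient (p v) (p (ordS v)) (p (V v k.+1)) by apply: first; lia.
  have hjk : 0 < s * orient (p v) (p (V v j)) (p (V v k)) by apply: IH; lia.
  have hkk : 0 < s * orient (p v) (p (V v k)) (p (V v k.+1)).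
    rewrite orientC; have := first (V v k) (n - k)%N.
    by rewrite /o /V -iterD subnK ?iter_ordS_period; [apply; lia | lia].
  rewrite -(pmulr_rgt0 _ hk) mulrACA orient_plucker mulrDr -!(mulrACA s _ s).
  by rewrite addr_gt0 // mulr_gt0.
move=> v i j k /andP[ij jk] kn.
have E h : (i <= h)%N -> iter h (@ordS n) v = V (V v i) (h - i)%N.
  by move=> le_h; rewrite /V -iterD subnK.
rewrite (E j (ltnW ij)) (E k); last exact: ltnW (ltn_trans ij jk).
by apply: base; lia.
Qed.

End Convex.

(** * Blockers and co-blockers of a convex polygon *)

Section Turns.
Variable m : nat.
Implicit Types v w : 'I_(2 * m).

(** The lengths of the two arcs between the vertices add up to the even number [2 * m], so they have
    the same parity. *)
Lemma odd_edge_order v w : odd (edge_order v w) = odd v (+) odd w.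
Proof.
rewrite /edge_order; move: (ltn_ord v) (ltn_ord w); move: (v : nat) (w : nat) => i j.
move=> lt_i lt_j; have -> : `|j%:Z - i%:Z|%N = ((j - i) + (i - j))%N by lia.
by rewrite /minn; case: ifP => _; lia.
Qed.

Lemma odd_iter_ordS v k : odd (iter k (@ordS _) v) = odd v (+) odd k.
Proof. by rewrite (val_iter_ordS k v) odd_mod ?oddM // oddD. Qed.

Definition turn v := traject (@ordS _) v (2 * m).

Lemma turn_uniq v : uniq (turn v).
Proof.
apply/(uniqP v) => i k; rewrite !inE size_traject => lt_i lt_k.
by rewrite !nth_traject //; apply: iter_ordS_inj.
Qed.

Lemma mem_turn v w : w \in turn v.
Proof.
by apply/trajectP; have [k lt_k ->] := iter_ordS_onto v w; exists k.
Qed.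

Lemma rot_turn k v : exists w, rot k (turn v) = turn w.
Proof.
elim: k => [|k [w Ew]]; first by exists v; rewrite rot0.
case: (ltnP k (size (turn v))) => [lt_k | le_k].
  exists (ordS w); rewrite -[k.+1]/(1 + k)%N rotD // Ew /turn.
  have := iter_ordS_period w; move: (ltn_ord w); case: (2 * m)%N w {Ew} => // n w _ Ep.
  by rewrite [LHS]/= rot1_cons trajectSr -iterSr Ep.
by exists w; rewrite -Ew !rot_oversize // leqW.
Qed.

End Turns.

Section Blockers.
Variables (R : realType) (m : nat) (p : 'I_(2 * m) -> 'rV[R]_2).
Variable s : R.
Hypothesis ccw : forall v i j k, (i < j < k)%N -> (k < 2 * m)%N ->
  0 < s * orient (p (iter i (@ordS _) v)) (p (iter j (@ordS _) v)) (p (iter k (@ordS _) v)).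
Implicit Types (u v w : 'I_(2 * m)) (e : {set 'I_(2 * m)}) (B C M : {set {set 'I_(2 * m)}}).

Local Notation V v k := (iter k (@ordS (2 * m)) v).

(** Through this lemma, a set of edges meeting all simple perfect matchings blocks the list
    [turn v]. *)
Lemma ncm_spm v M : ncm (turn v) M -> simple_perfect_matching p M.
Proof.
move=> vM; pose t a b c := 0 < s * orient (p a) (p b) (p c).
have tC x y z : t x y z = t y z x by rewrite /t orientC.
have tP a b c d : t a b c -> t a b d ->
    disjoint_edges p [set a; b] [set c; d] /\ disjoint_edges p [set c; d] [set a; b].
  move=> tc td; split=> -[x [xe xf]]; first exact: edges_apart tc td xe xf.
  exact: edges_apart tc td xf xe.
have tv : triwise t (turn v).
  apply: (triwise_nth (x0 := v)) => i j k ijk; rewrite size_traject => kn.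
  have /andP[ij jk] := ijk.
  rewrite !nth_traject ?(ltn_trans jk) ?(ltn_trans ij) ?(ltn_trans jk) //.
  exact: ccw.
have [M2 SM MP] := ncm_pairwise tC tP vM (turn_uniq v) tv.
split=> //; first by apply/subsetP => e /M2 e2; rewrite inE e2.
by apply/eqP; rewrite -(eqn_pmul2l (m := 2)) // SM size_traject.
Qed.

Lemma spm_exists : exists M, simple_perfect_matching p M.
Proof.
have [m_gt0 | m_le0] := ltnP 0 m; last first.
  exists set0; split=> [||e f]; rewrite ?sub0set ?cards0 ?inE //.
  by apply/eqP; rewrite eq_sym -leqn0.
have n_gt0 : (0 < 2 * m)%N by lia.
have [|//|M vM _] := @sorted_ncm _ set0 (turn (Ordinal n_gt0)).
- by rewrite size_traject oddM.
- by apply/(sortedP (Ordinal n_gt0)) => i _; rewrite inE.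
by exists M; apply: ncm_spm vM.
Qed.

(** * Partners in a simple perfect matching *)

Section Simple.
Variable M : {set {set 'I_(2 * m)}}.
Hypothesis spmM : simple_perfect_matching p M.

(** Disjoint edges share no vertex, so degrees are at most one; [m] edges on [2 * m] vertices force
    equality. *)
Lemma spm_star v : #|star M v| = 1%N.
Proof.
have [/subsetP M2 Mm disjM] := spmM.
have st1 x : x \in [set: 'I_(2 * m)] -> (#|star M x| <= 1)%N.
  move=> _; rewrite leqNgt; apply/negP => /card_gt1P [e [f [+ + ef]]].
  rewrite !inE => /andP[eM xe] /andP[fM xf].
  apply: (disjM e f eM fM ef); exists (p x).
  have in_x g : g \in M -> x \in g -> in_edge p g (p x).
    move=> gM xg; have := M2 g gM; rewrite inE => /eqP g2.
    have [y _ ->] := cards2_ex g2 xg.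
    by exists x, y, 0; split; rewrite ?lexx ?ler01 // subr0 scale1r scale0r addr0.
  by split; apply: in_x.
apply: (sum_le1_eq st1) => //; rewrite sum_star ?Mm ?cardsT ?card_ord //.
by move=> e /M2; rewrite inE subsetT => /eqP.
Qed.

Lemma spm_partner v : exists x, [/\ (0 < x)%N, (x < 2 * m)%N & [set v; V v x] \in M].
Proof.
have [/subsetP M2 _ _] := spmM.
have /card_gt0P [e] : (0 < #|star M v|)%N by rewrite spm_star.
rewrite inE => /andP[eM ve]; have := M2 e eM; rewrite inE => /eqP e2.
have [y vy Ee] := cards2_ex e2 ve; have [x lt_x Ey] := iter_ordS_onto v y.
exists x; rewrite -Ey -Ee; split=> //; case: x Ey {lt_x} => // Ey.
by rewrite Ey eqxx in vy.
Qed.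

Lemma spm_shared e f v : e \in M -> f \in M -> v \in e -> v \in f -> e = f.
Proof. by move=> eM fM ve vf; apply: star_eq eM ve fM vf; rewrite spm_star. Qed.

(** A partner outside the arc cut off by the chord would make the two edges interleave, hence
    intersect. *)
Lemma spm_nested v x k y : (0 < k < x)%N -> (x < 2 * m)%N -> (y < 2 * m)%N ->
    [set v; V v x] \in M -> [set V v k; V v y] \in M ->
  (0 < y < x)%N.
Proof.
move=> /andP[k0 kx] xn yn xM yM; have kn := ltn_trans kx xn.
have V_inj i j : (i < 2 * m)%N -> (j < 2 * m)%N -> V v i = V v j -> i = j.
  exact: iter_ordS_inj.
have notk : V v k \notin [set v; V v x].
  rewrite !inE; apply/norP; split; apply/eqP => E.
    by have Ek := V_inj k 0%N kn (ltn_trans k0 kn) E; rewrite Ek in k0.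
  by have Ek := V_inj _ _ kn xn E; rewrite Ek ltnn in kx.
have noty : V v y \notin [set v; V v x].
  apply: contra notk => yx; rewrite -(spm_shared yM xM (set22 _ _) yx).
  exact: set21.
have [y0 yx] : y <> 0%N /\ y <> x.
  by split=> E; move: noty; rewrite E !inE eqxx ?orbT.
rewrite lt0n; apply/andP; split; first exact/eqP.
rewrite ltn_neqAle; apply/andP; split; first exact/eqP.
rewrite leqNgt; apply/negP => xy.
have [_ _ disjM] := spmM.
have := @interleaved_meet R _ p s ccw v 0 k x y.
rewrite k0 kx xy yn => /(_ isT isT); apply.
apply: disjM => //; apply: contra noty => /eqP ->.
exact: set22.
Qed.

(** The [x.-1] vertices under the chord are matched among themselves, so their number is even. *)
Lemma spm_odd v x : (x < 2 * m)%N -> [set v; V v x] \in M -> odd x.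
Proof.
move=> xn xM; have [/subsetP M2 _ _] := spmM.
have M_2 e : e \in M -> #|e| = 2%N by move/M2; rewrite inE => /eqP.
have x0 : (0 < x)%N.
  by rewrite lt0n; apply: contraTneq xM => ->; apply/negP => /M_2; rewrite setUid cards1.
pose l := [seq V v k | k <- iota 1 x.-1].
have lP w : reflect (exists2 k, (0 < k < x)%N & w = V v k) (w \in l).
  apply: (iffP mapP) => [[k]|[k k_x ->]].
    by rewrite mem_iota => k_x ->; exists k => //; lia.
  by exists k; rewrite ?mem_iota //; lia.
have Ul : uniq l.
  rewrite map_inj_in_uniq ?iota_uniq // => i k; rewrite !mem_iota => i_x k_x.
  by apply: iter_ordS_inj; lia.
have st1 w : w \in [set w in l] -> #|star (inside M l) w| = 1%N.
  rewrite inE => wl; apply: etrans (spm_star w); apply: eq_card => e.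
  rewrite !inE andbAC; apply: andb_idr => /andP[eM we].
  have [k kx Ew] := lP _ wl; have [y _ Ee] := cards2_ex (M_2 e eM) we.
  have [j jn Ey] := iter_ordS_onto v y.
  have jx : (0 < j < x)%N.
    by apply: (spm_nested kx xn jn xM); rewrite -Ew -Ey -Ee.
  apply/subsetP => z; rewrite Ee !inE => /orP[] /eqP ->; apply/lP.
    by exists k.
  by exists j.
have := sum_star_inside Ul M_2; rewrite (eq_bigr _ st1) sum1_card size_setl // size_map size_iota.
by lia.
Qed.

End Simple.

(** Index 0 is the spine. Any other [j] is a leaf edge, at [v] if the distance [2j+1] exceeds [t]
    and at [ordS v] otherwise. Indexing by ['I_m] bounds the number of edges by [m]. *)
Definition fan_edge v t j : {set 'I_(2 * m)} :=
  if (t < j.*2.+1)%N || (j == 0%N) then [set v; V v j.*2.+1]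
  else [set ordS v; V v j.*2].

(* The caterpillar with the single spine edge [v, v+1]; [fan v 0] is a star. *)
Definition fan v t := [set fan_edge v t j | j : 'I_m].

Lemma fan_edges v t : fan v t \subset edges (2 * m).
Proof.
apply/subsetP => e /imsetP [j _ ->]; rewrite inE /fan_edge.
have V_neq i k : (i < 2 * m)%N -> (k < 2 * m)%N -> i != k -> #|[set V v i; V v k]| == 2%N.
  move=> lt_i lt_k ik; rewrite cards2; suff -> : V v i != V v k by [].
  by apply: contra ik => /eqP /(iter_ordS_inj lt_i lt_k) ->.
have := ltn_ord j; case: ifP => jt lt_j; [apply: (V_neq 0%N) | apply: (V_neq 1%N)]; lia.
Qed.

(** Let [x] be the distance from [v] to its partner. If [x] is 1 or exceeds [t], this edge is in the
    fan. Otherwise the partner of [ordS v] is trapped under the chord, at an even distance from [v]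
    below [t], and that edge is in the fan. *)
Lemma fan_meets v t M : simple_perfect_matching p M -> meet (fan v t) M.
Proof.
move=> spmM; have [x [x0 xn xM]] := spm_partner spmM v.
have xodd := spm_odd spmM xn xM.
have hit j : (j < m)%N -> fan_edge v t j \in M -> meet (fan v t) M.
  move=> lt_j jM; apply/set0Pn; exists (fan_edge v t j); rewrite inE jM andbT.
  by apply/imsetP; exists (Ordinal lt_j).
have [tx | xt] := ltnP t x.
  have Ex : x = (x./2).*2.+1 by lia.
  by apply: (hit x./2); [lia | rewrite /fan_edge -Ex tx].
have [x1 | x1] := leqP x 1.
  have Ex : x = 1%N by lia.
  by apply: (hit 0%N); [lia | rewrite /fan_edge orbT; move: xM; rewrite Ex].
have [y [y0 yn yM]] := spm_partner spmM (ordS v).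
have yodd := spm_odd spmM yn yM.
have [k kn Ek] := iter_ordS_onto v (V (ordS v) y); rewrite Ek in yM.
have kodd : ~~ odd k.
  have := congr1 (fun w : 'I_(2 * m) => odd w) Ek.
  rewrite /= !odd_iter_ordS -[ordS v]/(V v 1) odd_iter_ordS yodd.
  by case: (odd v); case: (odd k).
have /andP[k0 kx] : (0 < k < x)%N by apply: (@spm_nested M spmM v x 1 k).
have E : k = k./2.*2 by lia.
apply: (hit k./2); first by lia.
rewrite /fan_edge -E; case: ifP => // /orP [tk | /eqP k2]; last by lia.
by move: (leq_trans kx xt); lia.
Qed.

Lemma meets_all_card (v0 : 'I_(2 * m)) B :
  meets_all (simple_perfect_matching p) B -> (m <= #|B|)%N.
Proof.
case=> /subsetP B2 Bmeets.
apply: leq_trans (_ : (#|inside B (turn v0)| <= _)%N).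
  apply: (blocks_card (turn_uniq v0)); first by rewrite size_traject.
    by move=> e /B2; rewrite inE => /eqP.
  move=> M /ncm_spm/Bmeets/set0Pn [e]; rewrite inE => /andP[eB eM].
  by exists e.
by apply/subset_leq_card/subsetP => e /insideP[].
Qed.

Lemma fan_blocker v t : blocker p (fan v t).
Proof.
have fanA : meets_all (simple_perfect_matching p) (fan v t).
  by split; [apply: fan_edges | move=> M; apply: fan_meets].
split=> // B /(meets_all_card v); apply: leq_trans.
by rewrite -[X in (_ <= X)%N]card_ord; apply: leq_imset_card.
Qed.

Lemma blocker_tight v B : blocker p B -> tight m B (turn v).
Proof.
case=> BA Bmin; have Bm := meets_all_card v BA.
have [/subsetP B2 Bmeets] := BA.
split; first exact: turn_uniq.
- by rewrite size_traject.
- by move=> e /B2; rewrite inE => /eqP; split=> // w _; apply: mem_turn.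
- by move=> M /ncm_spm/Bmeets/set0Pn [e]; rewrite inE => /andP[eB eM]; exists e.
apply/eqP; rewrite eqn_leq Bm andbT.
have [fanA _] := fan_blocker v 0.
apply: leq_trans (Bmin _ fanA) _.
by rewrite -[X in (_ <= X)%N]card_ord; apply: leq_imset_card.
Qed.

(** For [m = 0] the empty matching is simple and perfect, and no set meets it. *)
Lemma blocker_gt0 B : blocker p B -> (0 < m)%N.
Proof.
case=> -[B2 /(_ _)]; rewrite lt0n => Bmeets _; apply/eqP => m0.
have [M spmM] := spm_exists; have := Bmeets M spmM.
have [_ Mm _] := spmM; have /cards0_eq -> : #|M| = 0%N by rewrite Mm.
by rewrite /meet setI0 eqxx.
Qed.

(** * Necessity: the structure of co-blockers *)

Lemma co_blocker_star C v : meets_all (blocker p) C ->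
  exists2 j, (j < m)%N & [set v; V v j.*2.+1] \in C.
Proof.
case=> _ /(_ _ (fan_blocker v 0))/set0Pn [e].
rewrite inE => /andP[eC /imsetP [j _ Ee]]; exists (j : nat) => //.
by rewrite -[[set v; _]]/(fan_edge v 0 j) -Ee.
Qed.

(** Meeting the star at each vertex means covering all [2 * m] vertices. *)
Lemma co_blocker_card C : meets_all (blocker p) C -> (m <= #|C|)%N.
Proof.
move=> CA; have /subsetP C2 := CA.1; rewrite -(leq_pmul2l (m := 2)) //.
rewrite -(@sum_star _ C setT); last by move=> e /C2; rewrite inE subsetT => /eqP.
rewrite -[X in (X <= _)%N]card_ord -cardsT -sum1_card; apply: leq_sum => v _.
by have [j _ jC] := co_blocker_star v CA; apply: star_gt0 jC (set21 _ _).
Qed.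

(** A simple perfect matching meets every blocker, so its size bounds that of [C]. *)
Lemma co_blocker_card_eq C : co_blocker p C -> #|C| = m.
Proof.
move=> [CA Cmin]; apply/eqP; rewrite eqn_leq co_blocker_card // andbT.
have [M spmM] := spm_exists; have [M2 Mm _] := spmM.
suff: (#|C| <= #|M|)%N by rewrite Mm.
apply: Cmin.
split=> // B [[_ BM] _]; rewrite /meet setIC; exact: BM.
Qed.

Lemma co_blocker_stars C v : co_blocker p C -> #|star C v| = 1%N.
Proof.
move=> CB; have Cm := co_blocker_card_eq CB; have [CA _] := CB.
have /subsetP C2 := CA.1.
have st1 w : w \in [set: 'I_(2 * m)] -> (1 <= #|star C w|)%N.
  by move=> _; have [j _ jC] := co_blocker_star w CA; apply: star_gt0 jC (set21 _ _).
apply: (sum_ge1_eq st1) => //; rewrite sum_star ?Cm ?cardsT ?card_ord //.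
by move=> e /C2; rewrite inE subsetT => /eqP.
Qed.

Lemma co_blocker_odd C v w : co_blocker p C -> [set v; w] \in C -> odd v (+) odd w.
Proof.
move=> CB vwC; have [CA _] := CB; have [j _ jC] := co_blocker_star v CA.
have /set2_injr <- : [set v; V v j.*2.+1] = [set v; w].
  by apply: star_eq jC (set21 _ _) vwC (set21 _ _); rewrite co_blocker_stars.
by rewrite odd_iter_ordS /= odd_double addbA addbb.
Qed.

Lemma co_blocker_not_cross C v b c : co_blocker p C ->
    [set v; b] \in C -> [set ordS v; c] \in C -> [set v; b] != [set ordS v; c] ->
  ~ cross p [set v; b] [set ordS v; c].
Proof.
move=> CB bC cC ne bc_cross.
have only e f w : e \in C -> w \in e -> f \in C -> w \in f -> e = f.
  by move=> eC we fC wf; apply: star_eq eC we fC wf; rewrite co_blocker_stars.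
have oddb := co_blocker_odd CB bC.
have [x xn Ex] := iter_ordS_onto v b; have [y yn Ey] := iter_ordS_onto v c; subst b c.
have xodd : odd x by move: oddb; rewrite odd_iter_ordS addbA addbb.
have x1 : x != 1%N.
  apply: contra ne => /eqP Ex; apply/eqP; apply: only bC _ cC (set21 _ _).
  by rewrite Ex set22.
have y0 : y != 0%N.
  by apply: contra ne => /eqP Ey; apply/eqP; apply: only bC (set21 _ _) cC _; rewrite Ey set22.
have yx : y != x.
  by apply: contra ne => /eqP Ey; apply/eqP; apply: only bC (set22 _ _) cC _; rewrite Ey set22.
have y1 : y != 1%N.
  have [/subsetP C2 _] := CB.1; have := C2 _ cC.
  by apply: contraTneq => Ey; rewrite inE Ey setUid cards1.
have [yx_lt | xy] := ltnP y x.
  by have := @nested_not_cross R _ p s ccw v 0 1 y x; apply; rewrite //; lia.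
(* Measured from [v], the edges of [C] at [v] and [ordS v] reach [x] and [y], with [x < y]. The
   edges of [fan v x] at [v] reach 1 or beyond [x], and its other edges at [ordS v] end before [x],
   so none of them is in [C]. *)
have [_ /(_ _ (fan_blocker v x))/set0Pn [e]] := CB.1.
rewrite inE => /andP[eC /imsetP [j _ Ee]]; have jm := ltn_ord j.
move: Ee; rewrite /fan_edge; case: ifP => jx Ee.
  have /set2_injr /(iter_ordS_inj xn) E : [set v; V v x] = [set v; V v j.*2.+1].
    by apply: only bC (set21 _ _) _ (set21 _ _); rewrite -Ee.
  by have := E _; lia.
have /set2_injr /(iter_ordS_inj yn) E : [set ordS v; V v y] = [set ordS v; V v j.*2].
  by apply: only cC (set21 _ _) _ (set21 _ _); rewrite -Ee.
by have := E _; lia.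
Qed.

(** Every blocker is a walk along some [turn a], so [walk_meets] applies once the hypotheses on [C]
    are read in positions from [a]. Minimality comes from [co_blocker_card]. *)
Lemma co_blockerP C :
    perfect_matching C ->
    (forall v w, [set v; w] \in C -> odd v (+) odd w) ->
    (forall v b c, [set v; b] \in C -> [set ordS v; c] \in C ->
       [set v; b] != [set ordS v; c] -> ~ cross p [set v; b] [set ordS v; c]) ->
  co_blocker p C.
Proof.
move=> [C2 Cm Cpm] Codd Cnc.
have only e f w : e \in C -> w \in e -> f \in C -> w \in f -> e = f.
  by move=> eC we fC wf; have [g [_ gP]] := Cpm w; rewrite -(gP e) // -(gP f).
have partner v : exists x, [/\ (0 < x)%N, (x < 2 * m)%N & [set v; V v x] \in C].
  have [e [[eC ve] _]] := Cpm v; have := subsetP C2 e eC; rewrite inE => /eqP e2.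
  have [y vy Ee] := cards2_ex e2 ve; have [x lt_x Ey] := iter_ordS_onto v y.
  exists x; rewrite -Ey -Ee; split=> //; case: x Ey {lt_x} => // Ey.
  by rewrite Ey eqxx in vy.
suff CA : meets_all (blocker p) C by split=> // C' /co_blocker_card; rewrite Cm.
split=> // B BB; have m_gt0 := blocker_gt0 BB.
have n_gt0 : (0 < 2 * m)%N by lia.
have tB := blocker_tight (Ordinal n_gt0) BB.
have [m' Em] : exists m', m = m'.+1 by case: (m) m_gt0 => // m'; exists m'.
have tB' : tight m'.+1 B (turn (Ordinal n_gt0)) by rewrite -Em.
have [k [_ [_ [_ [_ + _]]]]] := tight_walk tB'.
have [a ->] := rot_turn k (Ordinal n_gt0) => W.
have [x [x0 xn xC]] := partner a.
have V_inj i j : (i < 2 * m)%N -> (j < 2 * m)%N -> V a i = V a j -> i = j.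
  exact: iter_ordS_inj.
have parC i j : (i < 2 * m)%N -> (j < 2 * m)%N ->
    [set V a i; V a j] \in C -> odd i != odd j.
  move=> _ _ /Codd; rewrite !odd_iter_ordS.
  by case: (odd a); case: (odd i); case: (odd j).
(* If the partner of the next vertex were not under the chord, the two edges would interleave and
   cross. *)
have nestC i z : (i.+1 < z < 2 * m)%N -> [set V a i; V a z] \in C ->
    exists2 y, (i.+1 < y < z)%N & [set V a i.+1; V a y] \in C.
  move=> /andP[iz zn] zC; have i1n := ltn_trans iz zn; have in_ := ltnW i1n.
  have [w [w0 wn wC]] := partner (V a i.+1).
  have [y yn Ey] := iter_ordS_onto a (V (V a i.+1) w); rewrite Ey in wC.
  have notz : V a i.+1 \notin [set V a i; V a z].
    rewrite !inE; apply/norP; split; apply/eqP => E.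
      by have := V_inj _ _ i1n in_ E; lia.
    by have := V_inj _ _ i1n zn E; lia.
  have ne : [set V a i; V a z] != [set V a i.+1; V a y].
    by apply: contra notz => /eqP ->; apply: set21.
  have yi : y != i.
    apply: contra ne => /eqP E; apply/eqP.
    by apply: (only _ _ (V a i)) zC (set21 _ _) wC _; rewrite E set22.
  have yz : y != z.
    apply: contra ne => /eqP E; apply/eqP.
    by apply: (only _ _ (V a z)) zC (set22 _ _) wC _; rewrite E set22.
  have yi1 : y != i.+1.
    by apply/eqP => E; have := parC _ _ i1n yn wC; rewrite E eqxx.
  have nc := Cnc _ _ _ zC wC ne.
  exists y => //; apply: contraT => y_out; case: nc.
  have [zy | yz_lt] := ltnP z y.
    by apply: (@interleaved_cross R _ p s ccw a i i.+1 z y); lia.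
  (* Here [y] comes before [i], so the two edges exchange roles. *)
  have [q [qi1 qiz]] : cross p [set V a y; V a i.+1] [set V a i; V a z].
    by apply: (@interleaved_cross R _ p s ccw a y i i.+1 z); lia.
  by exists q; rewrite [[set ordS _; _]]set2C.
have [|k' | | e eB eC] := walk_meets (x0 := a) parC nestC W (j := 0%N) (x := x) _ _ _ xC.
- by rewrite size_traject.
- by rewrite size_traject => kn; rewrite nth_traject.
- by rewrite size_traject x0.
by apply/set0Pn; exists e; rewrite inE eC.
Qed.

End Blockers.

Theorem theorem1 (R : realType) (m : nat) (p : 'I_(2 * m) -> 'rV[R]_2)
    (hp : convex_polygon p) (C : {set {set 'I_(2 * m)}}) :
  co_blocker p C <->
  [/\ perfect_matching C,
      forall i j : 'I_(2 * m), [set i; j] \in C -> odd (edge_order i j) &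
      forall a b a' c : 'I_(2 * m),
        [set a; b] \in C -> [set a'; c] \in C -> [set a; b] != [set a'; c] ->
        adjacent a a' -> ~ cross p [set a; b] [set a'; c]].
Proof.
have [s ccw] := convex_ccw hp; split=> [CB | [Cpm Codd Cnc]].
  split.
  - split; [exact: CB.1.1 | exact: co_blocker_card_eq ccw _ CB |].
    move=> v; have [j _ jC] := co_blocker_star ccw v CB.1.
    exists [set v; iter j.*2.+1 (@ordS _) v]; split; first by rewrite jC set21.
    move=> e [eC ve]; apply: star_eq jC (set21 _ _) eC ve.
    by rewrite (co_blocker_stars ccw).
  - by move=> i j ijC; rewrite odd_edge_order; apply: co_blocker_odd ccw _ _ _ CB ijC.
  move=> a b a' c bC cC ne /orP[/eqP E | /eqP E]; subst.
    exact: co_blocker_not_cross ccw _ _ _ _ CB bC cC ne.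
  move=> [x [xb xc]]; apply: (co_blocker_not_cross ccw CB cC bC); first by rewrite eq_sym.
  by exists x.
apply: (co_blockerP ccw Cpm) => [v w /Codd|v b c vC cC ne]; first by rewrite odd_edge_order.
by apply: Cnc => //; rewrite /adjacent eqxx.
Qed.
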